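(* Let $\epsilon\le 1$ and $\delta\le 0.1$. For every $(\epsilon,\delta)$-differentially private algorithm $\mathcal{A}$ for the min $s$-$t$ cut problem on $n$-node graphs, there is an $n$-node input graph on which the expected additive error of $\mathcal{A}$ (expected value of the output cut minus the minimum $s$-$t$ cut value) is at least $n/20$.
   Context: A weighted undirected graph is $G=(V,E,w)$ with $w:V^2\to\mathbb{R}_{\ge 0}$, $w(uv)>0$ iff $uv\in E$ (unweighted graphs are the case of weights in $\{0,1\}$). For $A,B\subseteq V$, $E(A,B)$ is the set of edges with one endpoint in $A$ and the other in $B$. Given terminals $s\neq t$, an $s$-$t$ cut is a partition $(A,B)$ of $V$ with $s\in A$, $t\in B$, of value $w(E(A,B))$; the algorithm outputs such a cut. Two graphs on the same node set are neighboring if their weight functions differ on exactly one pair $uv$ and by at most $1$ there (and agree elsewhere). A randomized algorithm $\mathcal{A}$ is $(\epsilon,\delta)$-differentially private if for all neighboring $G,G'$ and every set $O$ of outputs, $\Pr[\mathcal{A}(G)\in O]\le e^{\epsilon}\Pr[\mathcal{A}(G')\in O]+\delta$.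
   Formalization: The formal theorem assumes n ≥ 4: for n = 2 the s-t cut is unique, so the error is 0, and for n = 3 there are (1, 0.1)-differentially private algorithms whose expected additive error stays below 3/20 on every graph. *)

(* Defs.v *)
From mathcomp Require Import all_boot all_order all_algebra.
From mathcomp Require Import all_classical all_reals all_analysis.

Set Implicit Arguments.
Unset Strict Implicit.
Unset Printing Implicit Defensive.

Import Order.TTheory GRing.Theory Num.Theory.

Local Open Scope ring_scope.

(* Edges join distinct nodes, hence [weight_irrefl]; a loop would contribute
   to no cut. *)
Record wgraph (R : realType) (V : finType) := WGraph {
  weight :> V -> V -> R;
  weight_ge0 : forall u v, 0 <= weight u v;
  weight_sym : forall u v, weight u v = weight v u;
  weight_irrefl : forall v, weight v v = 0 }.

Definition edge (R : realType) (V : finType) (G : wgraph R V) : rel V :=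
  fun u v => 0 < G u v.

(* For disjoint A and B, each undirected edge between A and B is represented
   exactly once, by the pair oriented from A to B. *)
Definition edges_between (R : realType) (V : finType) (G : wgraph R V)
    (A B : {set V}) : {set V * V} :=
  [set e : V * V | [&& e.1 \in A, e.2 \in B & edge G e.1 e.2]].

Definition is_st_cut (V : finType) (s t : V) : pred ({set V} * {set V}) :=
  fun c => [&& s \in c.1, t \in c.2, [disjoint c.1 & c.2]
             & c.1 :|: c.2 == [set: V]].

Definition st_cut (V : finType) (s t : V) : finType :=
  {c : {set V} * {set V} | is_st_cut s t c}.

Definition cut_value (R : realType) (V : finType) (s t : V) (G : wgraph R V)
    (c : st_cut s t) : R :=
  \sum_(e in edges_between G (val c).1 (val c).2) G e.1 e.2.

Definition min_cut_value (R : realType) (V : finType) (s t : V)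
    (G : wgraph R V) : R :=
  inf (range (@cut_value R V s t G)).

(* The infimum is a minimum as soon as s != t. *)
Lemma min_cut_valueP (R : realType) (V : finType) (s t : V) (G : wgraph R V) :
  s != t ->
  (exists c : st_cut s t, min_cut_value s t G = cut_value G c) /\
  (forall c : st_cut s t, min_cut_value s t G <= cut_value G c).
Proof.
move=> st.
have c0P : is_st_cut s t ([set~ t], [set t]).
  rewrite /is_st_cut /= !inE st eqxx /= finset.setUC finset.setUCr eqxx andbT.
  by rewrite disjoint_sym finset.disjoints_subset finset.setCK.
pose c0 : st_cut s t := Sub (_, _) c0P.
have [c _ cmin] := @arg_minP _ _ _ c0 predT (fun c => cut_value G c) isT.
have lbc : lbound (range (@cut_value R V s t G)) (cut_value G c).
  by move=> _ [c' _ <-]; exact: cmin.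
have E : min_cut_value s t G = cut_value G c.
  apply/eqP; rewrite eq_le; apply/andP; split.
    by apply: ge_inf; [exists (cut_value G c) | exists c].
  by apply: lb_le_inf => //; exists (cut_value G c), c.
by split; [exists c | move=> c'; rewrite E cmin].
Qed.

Record fdist (R : realType) (T : finType) := FDist {
  pmf :> T -> R;
  pmf_ge0 : forall x, 0 <= pmf x;
  pmf_sum1 : \sum_(x : T) pmf x = 1 }.

Definition Pr (R : realType) (T : finType) (d : fdist R T) (O : {set T}) : R :=
  \sum_(x in O) d x.

Definition Ex (R : realType) (T : finType) (d : fdist R T) (f : T -> R) : R :=
  \sum_(x : T) d x * f x.

(* A randomized algorithm with finitely many outputs is identified with the
   map sending each input to its output distribution. *)
Definition st_cut_algorithm (R : realType) (V : finType) (s t : V) : Type :=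
  wgraph R V -> fdist R (st_cut s t).

Definition neighboring (R : realType) (V : finType) (G G' : wgraph R V) : Prop :=
  exists u v : V,
    [/\ G u v != G' u v,
        `|G u v - G' u v| <= 1
      & forall x y : V, (x, y) != (u, v) -> (x, y) != (v, u) -> G x y = G' x y].

Definition diff_private (R : realType) (V : finType) (s t : V)
    (eps delta : R) (A : st_cut_algorithm R s t) : Prop :=
  forall G G' : wgraph R V, neighboring G G' ->
  forall O : {set st_cut s t},
    Pr (A G) O <= expR eps * Pr (A G') O + delta.

Definition expected_additive_error (R : realType) (V : finType) (s t : V)
    (A : st_cut_algorithm R s t) (G : wgraph R V) : R :=
  Ex (A G) (cut_value G) - min_cut_value s t G.

(* Main.v *)
Require Import Defs.
From mathcomp Require Import all_boot all_order all_algebra.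
From mathcomp Require Import all_classical all_reals all_analysis.
From mathcomp Require Import lra.

(** Join every inner node [v] to [s] with weight 1/2 and to [t] with weight 1
    or 0, according to whether [v] lies in a set [S]. A minimum cut puts exactly
    the inner nodes of [S] on the side of [t], and every misplaced inner node
    costs 1/2. Flipping the membership of [v] in [S] gives a neighboring graph,
    so by privacy the probabilities that [v] is misplaced for the two graphs sum
    to at least 2 (1 - delta) / (1 + e ^ eps) >= 2/5. Averaging over all [S]
    gives an expected error of at least (n - 2) / 10 >= n / 20 for some [S]. *)

Set Implicit Arguments.
Unset Strict Implicit.
Unset Printing Implicit Defensive.

Import Order.TTheory GRing.Theory Num.Theory.

Local Open Scope ring_scope.

(** The bound [1 + x <= expR x] at [x = - (1 / 6)] gives [expR (1 / 6) <= 6 / 5], and the sixth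
    power of 6/5 is 2.985984. A fifth root would fail, as the fifth power of 5/4 exceeds 3. *)
Lemma expR1_le3 (R : realType) : expR 1 <= 3 :> R.
Proof.
have le65 : expR (1 / 6) <= 6 / 5 :> R.
  have := expR_ge1Dx (- (1 / 6) : R); rewrite expRN => le56.
  rewrite -[leLHS]invrK invf_ple ?posrE ?invr_gt0 ?expR_gt0 //; lra.
have -> : expR 1 = expR (1 / 6) ^+ 6 :> R.
  by rewrite -expRM_natl; congr expR; lra.
by apply: le_trans (lerXn2r 6 _ _ le65) _; rewrite ?nnegrE ?expR_ge0 //; lra.
Qed.

Section Probability.
Context {R : realType} {T : finType}.
Implicit Types (d : fdist R T) (O : {set T}).

Lemma Pr_ge0 d O : 0 <= Pr d O.
Proof. by apply: sumr_ge0 => x _; exact: Defs.pmf_ge0. Qed.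

Lemma Pr_setC d O : Pr d (~: O)%SET = 1 - Pr d O.
Proof.
rewrite -(Defs.pmf_sum1 d) [in RHS](bigID (mem O)) /= addrAC subrr add0r /Pr.
by apply: eq_bigl => x; rewrite inE.
Qed.

Lemma Ex_indicator d O : Ex d (fun x => (x \in O)%:R) = Pr d O.
Proof.
rewrite /Pr big_mkcond; apply: eq_bigr => x _.
by case: (x \in O); rewrite ?mulr1 ?mulr0.
Qed.

Lemma ExB_cst d f (a : R) : Ex d (fun x => f x - a) = Ex d f - a.
Proof.
rewrite /Ex -[in RHS](mul1r a) -(Defs.pmf_sum1 d) mulr_suml -sumrB.
by apply: eq_bigr => x _; rewrite mulrBr.
Qed.

Lemma ExZ_sum d (I : finType) (P : pred I) (a : R) (f : I -> T -> R) :
  Ex d (fun x => a * \sum_(i | P i) f i x) = a * \sum_(i | P i) Ex d (f i).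
Proof.
rewrite /Ex exchange_big mulr_sumr; apply: eq_bigr => x _.
by rewrite mulrCA mulr_sumr.
Qed.

Lemma le_Ex d f g : (forall x, f x <= g x) -> Ex d f <= Ex d g.
Proof. by move=> fg; apply: ler_sum => x _; rewrite ler_wpM2l ?Defs.pmf_ge0. Qed.

End Probability.

Section StarGraph.
Context {R : realType} {V : finType} (s t : V).
Hypothesis neq_st : s != t.

Definition inner : {set V} := (~: [set s; t])%SET.

Lemma card_inner : #|inner| = (#|V| - 2)%N.
Proof. by rewrite cardsCs finset.setCK cards2 neq_st. Qed.

(** One orientation of the star edges, from a centre [s] or [t] to an inner node; [star_weight]
    symmetrizes it. *)
Definition star_arc (a b : V -> R) (u v : V) : R :=
  if v \in inner then (u == s)%:R * a v + (u == t)%:R * b v else 0.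

Section Weights.
Variables a b : V -> R.
Hypotheses (a_ge0 : forall v, 0 <= a v) (b_ge0 : forall v, 0 <= b v).

Definition star_weight (u v : V) : R := star_arc a b u v + star_arc a b v u.

Lemma star_arc_ge0 u v : 0 <= star_arc a b u v.
Proof. by rewrite /star_arc; case: ifP => // _; rewrite addr_ge0 ?mulr_ge0. Qed.

Lemma star_weight_ge0 u v : 0 <= star_weight u v.
Proof. by rewrite addr_ge0 ?star_arc_ge0. Qed.

Lemma star_weight_sym u v : star_weight u v = star_weight v u.
Proof. exact: addrC. Qed.

Lemma star_weight_irrefl v : star_weight v v = 0.
Proof.
rewrite /star_weight /star_arc; case: ifP => [|_]; last exact: addr0.
by rewrite !inE => /norP[/negPf -> /negPf ->]; rewrite !mul0r !addr0.
Qed.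

Definition star_graph : wgraph R V :=
  WGraph star_weight_ge0 star_weight_sym star_weight_irrefl.

End Weights.

Lemma cut_valueE (G : wgraph R V) (c : st_cut s t) :
  cut_value G c = \sum_(u in (val c).1) \sum_(v in (val c).2) G u v.
Proof.
rewrite pair_big /= /cut_value big_mkcond [RHS]big_mkcond.
apply: eq_bigr => -[u v] _; rewrite inE /= /edge.
case: (u \in _) => //=; case: (v \in _) => //=.
by case: ltP (weight_ge0 G u v) => // le0 ge0; apply/le_anti/andP.
Qed.

Lemma st_cutP (c : st_cut s t) :
  [/\ s \in (val c).1, t \notin (val c).1
    & forall v, (v \in (val c).1) = (v \notin (val c).2)].
Proof.
have /and4P[sA tB dAB /eqP cov] := valP c.
have E v : (v \in (val c).1) = (v \notin (val c).2).
  have : v \in (val c).1 :|: (val c).2 by rewrite cov inE.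
  rewrite inE; case: (boolP (v \in (val c).1)) => /= [vA _|_ ->] //.
  by rewrite (disjointFr dAB vA).
by split; rewrite // E tB.
Qed.

Lemma sum_star_arc (a b : V -> R) (A : {set V}) v :
  \sum_(u in A) star_arc a b u v
  = if v \in inner then (s \in A)%:R * a v + (t \in A)%:R * b v else 0.
Proof.
rewrite /star_arc; case: ifP => _; last by rewrite big1.
have sum_eq x : \sum_(u in A) (u == x)%:R = (x \in A)%:R :> R.
  rewrite big_mkcond (bigD1 x) //= eqxx big1 ?addr0 => [|u /negPf ->].
    by case: ifP.
  by case: ifP.
by rewrite big_split -!mulr_suml !sum_eq.
Qed.

(** An inner node on the side of [t] has only its edge to [s] cut, and one on the side of [s] only
    its edge to [t]; no other pair carries weight. *)
Lemma star_cut_value (a b : V -> R)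
    (a0 : forall v, 0 <= a v) (b0 : forall v, 0 <= b v) (c : st_cut s t) :
  cut_value (star_graph a0 b0) c
  = \sum_(v in inner) (if v \in (val c).2 then a v else b v).
Proof.
have [sA tA AE] := st_cutP c.
have sB : s \notin (val c).2 by rewrite -AE.
have tB : t \in (val c).2 by move: tA; rewrite AE negbK.
rewrite cut_valueE /= /star_weight.
under eq_bigr do rewrite big_split /=.
rewrite big_split exchange_big /=.
under eq_bigr do rewrite sum_star_arc sA (negPf tA) mul1r mul0r addr0.
under [X in _ + X]eq_bigr do rewrite sum_star_arc (negPf sB) tB mul1r mul0r add0r.
rewrite [RHS]big_mkcond [X in X + _]big_mkcond [X in _ + X]big_mkcond -big_split.
apply: eq_bigr => v _ /=; rewrite AE.
by case: (v \in (val c).2); case: (v \in inner); rewrite ?addr0 ?add0r.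
Qed.

Lemma half_ge0 (v : V) : 0 <= 1 / 2 :> R.
Proof. lra. Qed.

Lemma mem_ge0 (S : {set V}) (v : V) : 0 <= (v \in S)%:R :> R.
Proof. exact: ler0n. Qed.

Definition hard_graph (S : {set V}) : wgraph R V :=
  star_graph half_ge0 (mem_ge0 S).

Definition misplaced (S : {set V}) (v : V) : {set st_cut s t} :=
  [set c : st_cut s t | (v \in (val c).2) != (v \in S)].

Lemma hard_min_cut_le (S : {set V}) :
  min_cut_value s t (hard_graph S) <= \sum_(v in inner) (v \in S)%:R / 2.
Proof.
(* [S] is an arbitrary subset of [V], which may contain [s] or omit [t]; this repairs both without
   moving an inner node. *)
pose B : {set V} := (t |: (S :\ s))%SET.
have cP : is_st_cut s t (~: B, B)%SET.
  have cov : (~: B :|: B)%SET = [set: V] by rewrite finset.setUC finset.setUCr.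
  rewrite /is_st_cut /= cov eqxx andbT finset.disjoints_subset subxx andbT.
  by rewrite !inE !eqxx (negPf neq_st).
have [_ /(_ (Sub _ cP))] := min_cut_valueP (hard_graph S) neq_st.
move=> /le_trans; apply; rewrite star_cut_value SubK /=.
apply: ler_sum => v; rewrite !inE => /norP[/negPf -> /negPf ->] /=.
by case: (v \in S) => /=; lra.
Qed.

Lemma hard_error_ge (A : st_cut_algorithm R s t) (S : {set V}) :
  1 / 2 * \sum_(v in inner) Pr (A (hard_graph S)) (misplaced S v)
  <= expected_additive_error A (hard_graph S).
Proof.
under eq_bigr do rewrite -Ex_indicator.
rewrite -ExZ_sum /expected_additive_error -ExB_cst; apply: le_Ex => c.
apply: le_trans (lerB (lexx _) (hard_min_cut_le S)).
(* Node by node: the side of [t] costs 1/2, and the side of [s] costs 1 for a node of [S] and 0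
   otherwise. Subtracting 1/2 or 0 respectively leaves 1/2 if the node is misplaced and 0 if not. *)
rewrite star_cut_value -sumrB mulr_sumr; apply: ler_sum => v _.
by rewrite inE; case: (v \in (val c).2); case: (v \in S) => /=; lra.
Qed.

Definition toggle (v : V) (S : {set V}) : {set V} :=
  [set x | (x \in S) (+) (x == v)].

Lemma toggleK v : involutive (toggle v).
Proof. by move=> S; apply/setP => x; rewrite !inE addbK. Qed.

Lemma misplaced_toggle S v : misplaced (toggle v S) v = (~: misplaced S v)%SET.
Proof. by apply/setP => c; rewrite !inE eqxx addbT; case: (v \in (val c).2); case: (v \in S). Qed.

Lemma hard_graph_neighboring (S : {set V}) v :
  v \in inner -> neighboring (hard_graph S) (hard_graph (toggle v S)).
Proof.
move=> v_in; have := v_in; rewrite !inE => /norP[vs vt].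
(* The two graphs differ only on the pair [t], [v], where one weight is 0 and the other 1. *)
have E S' : hard_graph S' t v = (v \in S')%:R.
  rewrite /= /star_weight /star_arc v_in !inE eqxx orbT /=.
  by rewrite [t == s]eq_sym (negPf neq_st) mul0r mul1r add0r addr0.
exists t, v; rewrite !E !inE eqxx addbT; split.
- by case: (v \in S); rewrite /= ?oner_eq0 // eq_sym oner_eq0.
- by case: (v \in S); rewrite /= ?subr0 ?sub0r ?normrN normr1.
move=> x y xy yx /=; rewrite /star_weight; congr (_ + _).
- rewrite /star_arc !inE; move: xy; rewrite xpair_eqE.
  by case: (x == t); case: (y == v); rewrite //= ?addbF ?mul0r.
- rewrite /star_arc !inE; move: yx; rewrite xpair_eqE.
  by case: (x == v); case: (y == t); rewrite //= ?addbF ?mul0r.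
Qed.

Lemma misplaced_pair_ge (eps delta : R) (A : st_cut_algorithm R s t) S v :
  eps <= 1 -> delta <= 1 / 10 -> diff_private eps delta A -> v \in inner ->
  2 / 5 <= Pr (A (hard_graph S)) (misplaced S v)
           + Pr (A (hard_graph (toggle v S))) (misplaced (toggle v S) v).
Proof.
move=> eps1 delta1 dpA v_in.
have e3 : expR eps <= 3.
  by apply: le_trans (expR1_le3 R); rewrite ler_expR.
have H1 := dpA _ _ (hard_graph_neighboring (toggle v S) v_in) (misplaced S v).
have H2 := dpA _ _ (hard_graph_neighboring S v_in) (misplaced (toggle v S) v).
move: H1 H2; rewrite toggleK -[misplaced S v]finset.setCK -misplaced_toggle.
rewrite !Pr_setC.
(* Misplacing [v] for [toggle v S] means placing it correctly for [S], so the two error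
   probabilities are [1 - p] and [q]. Adding [H1] and [H2] gives [2 * (1 - delta) <= (1 + expR eps)
   * ((1 - p) + q)], hence a sum of at least 9/20. *)
set p := Pr (A (hard_graph S)) _; set q := Pr (A (hard_graph (toggle v S))) _.
have p1 : 0 <= 1 - p by rewrite -Pr_setC Pr_ge0.
have q0 : 0 <= q by exact: Pr_ge0.
move=> H1 H2; have := ler_wpM2r p1 e3; have := ler_wpM2r q0 e3; lra.
Qed.

(* Summing over [S] and over its image under the involution [toggle v] counts
   every term twice. *)
Lemma sum_misplaced_ge (eps delta : R) (A : st_cut_algorithm R s t) v :
  eps <= 1 -> delta <= 1 / 10 -> diff_private eps delta A -> v \in inner ->
  \sum_(S : {set V}) 1 / 5
  <= \sum_(S : {set V}) Pr (A (hard_graph S)) (misplaced S v).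
Proof.
move=> eps1 delta1 dpA v_in.
have := ler_sum (index_enum {set V}) (P := predT)
  (fun S _ => @misplaced_pair_ge eps delta A S v eps1 delta1 dpA v_in).
rewrite big_split /= -(reindex_inj (inv_inj (toggleK v)) (P := predT)
  (F := fun S => Pr (A (hard_graph S)) (misplaced S v))) /=.
by rewrite !sumr_const; lra.
Qed.

Lemma hard_instance (eps delta : R) (A : st_cut_algorithm R s t) :
  eps <= 1 -> delta <= 1 / 10 -> diff_private eps delta A ->
  exists S : {set V},
    #|inner|%:R / 10 <= expected_additive_error A (hard_graph S).
Proof.
move=> eps1 delta1 dpA; apply: contrapT => /forallNP none.
have : \sum_(S : {set V}) expected_additive_error A (hard_graph S)
    < \sum_(S : {set V}) #|inner|%:R / 10.
  apply: ltr_sum => [|S _]; last by rewrite ltNge; apply/negP/none.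
  (* Strictness of the summed inequality requires at least one index. *)
  by apply/hasP; exists finset.set0; rewrite ?mem_index_enum.
apply/negP; rewrite -leNgt.
apply: le_trans (ler_sum _ (fun S _ => hard_error_ge A S)).
(* With the sum over nodes outermost, the average over [S] is at least 1/5 for each inner node; the
   cost 1/2 turns this into 1/10. *)
rewrite -[leRHS]mulr_sumr exchange_big /=.
have := ler_sum (index_enum V) (P := mem inner)
  (fun v v_in => @sum_misplaced_ge eps delta A v eps1 delta1 dpA v_in).
rewrite exchange_big /= => /(ler_wpM2l (half_ge0 s)); apply: le_trans.
rewrite mulr_sumr; apply: ler_sum => S _.
by rewrite sumr_const -[_ *+ _]mulr_natr; lra.
Qed.

End StarGraph.

Theorem theorem2 (R : realType) (n : nat) (V : finType) (s t : V)
    (eps delta : R) (A : st_cut_algorithm R s t) :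
  (4 <= n)%N -> #|V| = n -> s != t ->
  eps <= 1 -> delta <= 1 / 10 ->
  diff_private eps delta A ->
  exists G : wgraph R V, n%:R / 20 <= expected_additive_error A G.
Proof.
move=> n4 cardV neq_st eps1 delta1 dpA.
have [S err] := hard_instance neq_st eps1 delta1 dpA.
exists (hard_graph s t S); apply: le_trans err.
rewrite card_inner // cardV natrB; last exact: leq_trans n4.
(* The inequality [(n - 2) / 10 >= n / 20] is equivalent to [n >= 4]. *)
have : 4 <= n%:R :> R by rewrite ler_nat.
lra.
Qed.
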